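(* Fix a finite set $\bm C=\{C_1,\dots,C_N\}$ of chance variables with finite domains and a decision variable $D$ with finite domain. For almost all causal influence diagrams $M=(G,P)$ over $(\{D\},\{U\},\bm C)$ satisfying - (Assumption 1, unmediated decision task) $\mathrm{Desc}_D\cap \mathrm{Anc}_U=\emptyset$, and - (Assumption 2, domain dependence) there exist environment distributions $P_1$ and $P_2$ of $\bm C$ compatible with $M$ such that no policy maximising $\mathbb E^{\pi}_{P_1}[U]$ also maximises $\mathbb E^{\pi}_{P_2}[U]$, the directed acyclic graph $G$ and the joint distribution $P$ over all ancestors $\mathrm{Anc}_U$ of the utility are identified by the family $\{\pi^*_\sigma(d\mid \mathrm{pa}_D)\}_{\sigma\in\Sigma}$, where $\pi^*_\sigma$ is an optimal policy in the domain $\sigma$ and $\Sigma$ is the set of all mixtures of local interventions. Explicitly: there is a map $R$, depending only on $\bm C$, $D$ and their domains, whose input is the utility function $U(\cdot)$ (with its argument set $\mathrm{Pa}_U$), the set $\mathrm{Pa}_D$, and a family of policies indexed by $\Sigma$, such that the following holds. For every DAG $G$ satisfying Assumption 1, the set of parameters (conditional probabilities $P(c_i\mid \mathrm{pa}_i)$ and utility values $U(\mathrm{pa}_U)$) for which Assumption 2 holds but the following property fails has Lebesgue measure zero: for every choice of a family $\{\pi^*_\sigma\}_{\sigma\in\Sigma}$ with $\pi^*_\sigma$ optimal in the domain $\sigma$, the output $R\big(U,\mathrm{Pa}_D,\{\pi^*_\sigma\}_{\sigma\in\Sigma}\big)$ equals the pair consisting of the subgraph of $G$ induced on $\mathrm{Anc}_U$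 and the joint distribution of the chance variables in $\mathrm{Anc}_U$.
   Context: **Causal influence diagram (CID).** A (single-decision, single-utility) CID $M=(G,P)$ consists of a DAG $G$ on the variables $\bm C\cup\{D,U\}$ (chance variables $\bm C$, decision $D$, utility $U$), conditional probability distributions $P(c_i\mid \mathrm{pa}_i)$ for each chance variable $C_i$ given its parents in $G$, and a real-valued function $U(\mathrm{pa}_U)$ giving the utility as a function of the values of its parents. $\mathrm{Pa}_D\subseteq\bm C$. For a node $X$, $\mathrm{Pa}_X,\mathrm{Anc}_X,\mathrm{Desc}_X$ are its parents, proper ancestors and proper descendants in $G$. $\bm C$ is assumed causally sufficient (contains all common causes). The diagram is causal: interventions act by replacing the factors in $\prod_i P(c_i\mid\mathrm{pa}_i)$. **Policies.** No distribution of $D$ is specified by $M$. A policy is a conditional distribution $\pi(d\mid \mathrm{pa}_D)$ chosen by the agent; $\mathbb E^\pi[U]$ is the resulting expected utility. A policy is optimal if it maximises $\mathbb E^\pi[U]$. Under Assumption 1 the joint law of the chance variables in $\mathrm{Anc}_U$ does not depend on the policy. **Compatible distributions.** An environment distribution is compatible with $M$ if it is given by some choice of conditional distributions of the $C_i$ given their parents in $G$ (same $G$ and same $U(\cdot)$). **Local interventions.** A local intervention on a chance variable $C_i$, written $\mathrm{do}(C_i=f(c_i))$, applies a map $f:\mathrm{dom}(C_i)\to\mathrm{dom}(C_i)$ to the states of $C_i$, i.e. it replaces $P(c_i\mid\mathrm{pa}_i)$ by $P(c_i\mid \mathrm{pa}_i;\sigma)=\sum_{c_i':f(c_i')=c_i}P(c_i'\mid\mathrm{pa}_i)$.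 Local interventions may be applied simultaneously to several chance variables. Hard interventions are the case of constant $f$. Masking of policy inputs, i.e. replacing $\mathrm{Pa}_D$ by a subset $\mathrm{Pa}_D'\subseteq\mathrm{Pa}_D$ so that the policy may depend only on $\mathrm{Pa}'_D$ (and optimality is among such policies), is also counted as a local intervention. Interventions never act on $U$ and do not otherwise act on $D$. **Mixtures.** A mixture $\sigma^*=\sum_i p_i\sigma_i$ ($p_i\ge0$, $\sum_i p_i=1$) performs $\sigma_i$ with probability $p_i$: $P(\bm v;\sigma^* )=\sum_i p_iP(\bm v;\sigma_i)$. **Domain $\sigma$.** The environment after applying $\sigma$. An optimal policy in domain $\sigma$ maximises expected utility in that environment. **Almost all.** With $G$ and the domains fixed, parameters are the free entries of the conditional probability tables $P(c_i\mid\mathrm{pa}_i)$ together with the values $U(\mathrm{pa}_U)$; ''almost all'' means outside a set of Lebesgue measure zero in this parameter space.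
   Formalization: Every chance variable is assumed to have at least two states: with a one-state C_2, the graphs with and without C_2 -> C_1 have the same parameters and optimal policies but different Anc_U, so no map R could tell them apart. U is taken to have no children, as usual. *)

(* Defs.v *)
From HB Require Import structures.
From mathcomp Require Import all_boot all_order all_algebra.
From mathcomp Require Import all_classical all_reals all_analysis.

Set Implicit Arguments.
Unset Strict Implicit.
Unset Printing Implicit Defensive.

Import Order.TTheory GRing.Theory Num.Theory.

Local Open Scope classical_set_scope.
Local Open Scope ring_scope.

(* n-dimensional Lebesgue measure, as the iterated product (\x) of the
   one-dimensional one, transported along (x, t) |-> x :: t.  In dimension 0
   it is the unit mass at the empty tuple. *)
Fixpoint lebesgue_tuple (R : realType) (n : nat) :
    set (n.-tuple (measurableTypeR R)) -> \bar R :=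
  match n return set (n.-tuple (measurableTypeR R)) -> \bar R with
  | 0 => fun A => (\d_([tuple] : 0.-tuple (measurableTypeR R)) A : \bar R)
  | m.+1 => pushforward (lebesgue_measure \x lebesgue_tuple (n := m))%E
              (fun p : measurableTypeR R * m.-tuple (measurableTypeR R) =>
                 cons_tuple p.1 p.2)
  end.
Arguments lebesgue_tuple R n _ : clear implicits.

Definition lebesgue_null (R : realType) (K : finType) (A : set (K -> R)) :=
  (lebesgue_tuple R #|K|).-negligible
    [set t : #|K|.-tuple (measurableTypeR R) |
       A (fun k => tnth t (enum_rank k))].

Section Graphs.
Context (T : finType).
Implicit Types G : {set T * T}.

Definition edge G : rel T := fun x y => (x, y) \in G.

Definition acyclic G := forall x y, edge G x y -> ~~ connect (edge G) y x.

(* Proper ancestors and descendants. *)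
Definition Anc G (x : T) : {set T} :=
  [set y | (y != x) && connect (edge G) y x]%SET.
Definition Desc G (x : T) : {set T} :=
  [set y | (y != x) && connect (edge G) x y]%SET.

Definition induced G (A : {set T}) : {set T * T} :=
  [set e in G | (e.1 \in A) && (e.2 \in A)]%SET.

End Graphs.

(* Variables are [Some i], for the chance variable C_i, and [None], for the
   decision D.  Nodes are [Some v], for a variable v, and [None], for U. *)
Definition var (N : nat) : finType := option 'I_N.
Definition node (N : nat) : finType := option (var N).

Definition chance (N : nat) (i : 'I_N) : node N := Some (Some i).
Definition nodeD {N : nat} : node N := Some None.
Definition nodeU {N : nat} : node N := None.

Section StructuralAssumptions.
Context (N : nat).
Implicit Types G : {set node N * node N}.

(* U has no children, so that the parents of every node are variables; together
   with acyclicity this gives that Pa_D consists of chance variables. *)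
Definition cid_graph G := acyclic G /\ (forall v, ~~ edge G nodeU v).

Definition Pa G (x : node N) : {set var N} := [set v | edge G (Some v) x]%SET.

Definition unmediated G := (Desc G nodeD :&: Anc G nodeU)%SET = finset.set0.

Definition chance_part (A : {set node N}) : {set var N} :=
  [set v | (Some v \in A) && (v != None)]%SET.

End StructuralAssumptions.

Section Models.
Context (R : realType) (N : nat) (dom : 'I_N -> finType) (act : finType).

Definition vdom (v : var N) : finType := if v is Some i then dom i else act.

Definition config (S : {set var N}) : finType :=
  {dffun forall v : {v : var N | v \in S}, vdom (val v)}.

Definition outcome : finType := {dffun forall v : var N, vdom v}.

Definition proj (S : {set var N}) (c : outcome) : config S :=
  [ffun v : {v : var N | v \in S} => c (val v)].

(* Conditional probability tables: [k x y] is the probability of y given x. *)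
Definition is_kernel (X Y : finType) (k : X -> Y -> R) :=
  forall x, (forall y, 0 <= k x y) /\ \sum_y k x y = 1.

Definition utility (PaU : {set var N}) := config PaU -> R.
Definition policy (PaD : {set var N}) := config PaD -> act -> R.

Definition depends_only_on (PaD m : {set var N}) (pi : policy PaD) :=
  forall x y : config PaD,
    (forall v, val v \in m -> x v = y v) -> pi x = pi y.

Definition maximises (T : Type) (S : T -> Prop) (J : T -> R) (t : T) :=
  S t /\ forall t', S t' -> J t' <= J t.

(* A local intervention: a map of its states for every chance variable (the
   identity where there is no intervention), and the set Pa_D' of the policy
   inputs that are not masked. *)
Definition local_intervention (PaD : {set var N}) : finType :=
  ({dffun forall i : 'I_N, {ffun dom i -> dom i}} *
   {m : {set var N} | m \subset PaD})%type.

Definition mixture (PaD : {set var N}) :=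
  {p : local_intervention PaD -> R | (forall s, 0 <= p s) /\ \sum_s p s = 1}.

Section FixedGraph.
Context (G : {set node N * node N}).

Definition cpts := forall i : 'I_N, config (Pa G (chance i)) -> dom i -> R.

Definition is_environment (P : cpts) := forall i, is_kernel (P i).

Definition joint (P : cpts) (pi : policy (Pa G nodeD)) (c : outcome) : R :=
  (\prod_(i < N) P i (proj _ c) (c (Some i))) * pi (proj _ c) (c None).

Definition marginal (S : {set var N}) (J : outcome -> R) (x : config S) : R :=
  \sum_(c | proj S c == x) J c.

Definition expected_utility (u : utility (Pa G nodeU)) (J : outcome -> R) : R :=
  \sum_c J c * u (proj _ c).

Definition intervene (P : cpts) (s : local_intervention (Pa G nodeD)) : cpts :=
  fun i x y => \sum_(y' | s.1 i y' == y) P i x y'.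

Definition mixture_joint (P : cpts) (sigma : mixture (Pa G nodeD))
    (pi : policy (Pa G nodeD)) (c : outcome) : R :=
  \sum_s sval sigma s * joint (intervene P s) pi c.

(* One and the same policy is used in all the components of a mixture, so it
   has to comply with the mask of each component that has positive weight. *)
Definition admissible (sigma : mixture (Pa G nodeD)) (pi : policy (Pa G nodeD)) :=
  is_kernel pi /\
  forall s, 0 < sval sigma s -> depends_only_on (val s.2) pi.

Definition optimal (u : utility (Pa G nodeU)) (P : cpts) :=
  maximises (@is_kernel _ _) (fun pi => expected_utility u (joint P pi)).

Definition optimal_in (u : utility (Pa G nodeU)) (P : cpts)
    (sigma : mixture (Pa G nodeD)) :=
  maximises (admissible sigma)
    (fun pi => expected_utility u (mixture_joint P sigma pi)).

Definition domain_dependence (u : utility (Pa G nodeU)) :=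
  exists P1 P2, [/\ is_environment P1, is_environment P2 &
    forall pi, optimal u P1 pi -> ~ optimal u P2 pi].

(* In each row of a table the entry of the reference state [c0 i] is not free:
   it is 1 minus the sum of the others. *)
Definition param (c0 : forall i, dom i) : finType :=
  ({i : 'I_N & (config (Pa G (chance i)) * {y : dom i | y != c0 i})%type}
   + config (Pa G nodeU))%type.

Definition cpts_of (c0 : forall i, dom i) (theta : param c0 -> R) : cpts :=
  fun i x y =>
    let entry (z : {z : dom i | z != c0 i}) := theta (inl (existT _ i (x, z))) in
    if insub y is Some z then entry z else 1 - \sum_z entry z.

Definition utility_of (c0 : forall i, dom i) (theta : param c0 -> R) :
    utility (Pa G nodeU) :=
  fun x => theta (inr x).

End FixedGraph.

(* A set of nodes, the edges between them, and a joint distribution of the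
   chance variables among them. *)
Record ancestral_model := AncestralModel {
  am_nodes : {set node N};
  am_edges : {set node N * node N};
  am_law : {ffun config (chance_part am_nodes) -> R}
}.

(* Given the policy, the factors P determine the law of all the variables; for
   an unmediated task the law of the ancestors of U is the same for every
   policy. *)
Definition utility_ancestors (G : {set node N * node N}) (P : cpts G)
    (pi : policy (Pa G nodeD)) : ancestral_model :=
  @AncestralModel (Anc G nodeU) (induced G (Anc G nodeU))
    [ffun x => marginal (joint P pi) x].

Definition reconstruction :=
  forall PaU PaD : {set var N},
    utility PaU -> (mixture PaD -> policy PaD) -> ancestral_model.

Definition reconstructs (rec : reconstruction) (G : {set node N * node N})
    (u : utility (Pa G nodeU)) (P : cpts G) :=
  forall family : mixture (Pa G nodeD) -> policy (Pa G nodeD),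
    (forall sigma, optimal_in u P sigma (family sigma)) ->
  forall pi, is_kernel pi -> rec _ _ u family = utility_ancestors P pi.

End Models.

(* Main.v *)
Require Import Defs.
From HB Require Import structures.
From mathcomp Require Import all_boot all_order all_algebra.
From mathcomp Require Import all_classical all_reals all_analysis.
From mathcomp Require Import ring lra.

(** Two generic worlds with the same utility function and parents of D and U,
    and with one family of policies optimal in all domains of both, have the
    same ancestral model; a reconstruction map can thus be obtained by choice.

    Mask the inputs of D that are not parents of U.  By domain dependence and
    genericity there are two configurations at which different decisions a and
    b are strictly best.  Mixing a local intervention f with the two hard
    interventions that produce these configurations, in all proportions, the
    optimal decisions reveal the difference ("gap") between the expected
    utilities of a and b under f.  Hence the gaps of all local interventions
    agree in both worlds.

    Let T be the set of parents of D and of U.  By induction on the distance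
    from a chance variable i to T, along a shortest path, there are local maps
    on the path such that, all other variables being held fixed, the state of i
    influences the gap: along a shortest path only consecutive variables
    interact, so the influence is a product of factors that are nonzero for
    generic parameters.  Mapping one state of i to a state x1 and all the others
    to x0 then expresses its probability given the parents by gaps, so i has
    the same table, and the same parents, in both worlds.

    All genericity conditions are complements of hyperplanes. *)

Set Implicit Arguments.
Unset Strict Implicit.
Unset Printing Implicit Defensive.

Import Order.TTheory GRing.Theory Num.Theory.

Local Open Scope classical_set_scope.
Local Open Scope ring_scope.

(** * Finite unions of hyperplanes are null *)

Section NullSets.
Context (R : realType).

(** All subsets of a finite set are measurable; hence so is [f] on [E], a null set. *)
Lemma integral_finite_support (E : set R) (f : R -> \bar R) :
  finite_set E -> (forall x, ~ E x -> f x = 0%E) ->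
  (\int[lebesgue_measure]_x f x = 0)%E.
Proof.
move=> finE f0.
have cE (A : set R) : A `<=` E -> measurable (A : set (measurableTypeR R)).
  move=> AE; apply: countable_measurable; first exact: measurable_set1.
  exact: finite_set_countable (sub_finite_set AE finE).
transitivity (\int[lebesgue_measure]_(x in E) f x)%E.
  rewrite [RHS]integral_mkcond; apply: eq_integral => x _.
  rewrite patchE; case: ifPn => // /negP xE; apply: f0 => Ex.
  by apply: xE; rewrite inE.
apply: null_set_integral.
- exact: cE.
- by move=> _ Y _; apply: cE => x [].
- exact/countable_lebesgue_measure0/finite_set_countable.
Qed.

Definition hyperplanes (J : finType) n (P : pred J) (a : J -> 'I_n -> R)
    (b : J -> R) :=
  [set t : n.-tuple (measurableTypeR R) |
    [exists j, P j && (\sum_i a j i * tnth t i == b j)]].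

Lemma measurable_hyperplanes (J : finType) n (P : pred J) (a : J -> 'I_n -> R)
    (b : J -> R) : measurable (hyperplanes P a b).
Proof.
rewrite (_ : hyperplanes P a b = \bigcup_(j in [set j | P j])
    ((fun t : n.-tuple (measurableTypeR R) => \sum_i a j i * tnth t i) @^-1`
       [set b j])); last first.
  apply/seteqP; split => t /=.
    by case/existsP => j /andP[Pj /eqP tj]; exists j.
  by case=> j Pj tj; apply/existsP; exists j; rewrite (Pj : P j) /=; apply/eqP.
apply: fin_bigcup_measurable => // j _.
rewrite -[X in measurable X]setTI.
suff /(_ measurableT) H : measurable_fun setT
    (fun t : n.-tuple (measurableTypeR R) => \sum_i a j i * tnth t i : R).
  by apply: H; exact: measurable_set1.
apply: measurable_sum => i; apply: measurable_realfun.measurable_funM => //.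
exact: measurable_tnth.
Qed.

(** Induction on the dimension: for all but finitely many values of the first coordinate, the
    section is again a finite union of hyperplanes. *)
Lemma lebesgue_tuple_hyperplanes (J : finType) n (P : pred J)
    (a : J -> 'I_n -> R) (b : J -> R) :
  (forall j, P j -> exists i, a j i != 0) ->
  lebesgue_tuple R n (hyperplanes P a b) = 0%E.
Proof.
elim: n P a b => [|n IHn] P a b aN0.
  rewrite /lebesgue_tuple /hyperplanes diracE memNset// => /existsP[j].
  by case/andP => /aN0[[]].
pose tail j := [exists i, a j (lift ord0 i) != 0].
(* The values of the first coordinate that solve an equation in this coordinate alone. *)
pose E := [set x | exists2 j, P j && ~~ tail j & x = b j / a j ord0].
rewrite /= /pushforward /product_measure1.
apply: (@integral_finite_support E).
  rewrite (_ : E = (fun j => b j / a j ord0) @` [set j | P j && ~~ tail j]).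
    by apply: finite_image.
  by apply/seteqP; split => [x [j ? ->]|x [j ? <-]]; exists j.
move=> x Ex /=.
rewrite (_ : xsection _ _ = hyperplanes (fun j => P j && tail j)
    (fun j i => a j (lift ord0 i)) (fun j => b j - a j ord0 * x)).
  by apply: IHn => j /andP[_ /existsP].
rewrite xsectionE; apply/seteqP; split => t /=.
  case/existsP => j; rewrite big_ord_recl /= => /andP[Pj /eqP tj].
  have tlj : tail j.
    case: (boolP (tail j)) => [//|ntj].
    exfalso; apply: Ex; exists j; first by apply/andP.
    have [i ai] := aN0 _ Pj.
    have tl0 i' : a j (lift ord0 i') = 0.
      apply/eqP; apply: contraNT ntj => ?; by apply/existsP; exists i'.
    move: tj; rewrite big1 => [|i' _]; last by rewrite tl0 mul0r.
    rewrite addr0 (tnth_nth x) /= => <-; rewrite mulrAC mulfV ?mul1r//.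
    by case: (unliftP ord0 i) ai => [i' ->|-> //]; rewrite tl0 eqxx.
  apply/existsP; exists j; apply/andP.
  split; [by apply/andP|apply/eqP].
  rewrite -tj (tnth_nth x) /= addrAC subrr add0r.
  by apply: eq_bigr => i _; rewrite !(tnth_nth x) /=.
case/existsP => j /andP[/andP[Pj _] /eqP tj]; apply/existsP; exists j.
rewrite Pj /= big_ord_recl (tnth_nth x) /=; apply/eqP.
rewrite -[RHS](subrK (a j ord0 * x)) -tj addrC; congr (_ + _).
by apply: eq_bigr => i _; rewrite !(tnth_nth x) /=.
Qed.

Lemma lebesgue_null_hyperplanes (K J : finType) (P : pred J) (a : J -> K -> R)
    (A : set (K -> R)) :
  (forall j, P j -> exists k, a j k != 0) ->
  (forall x, A x -> exists2 j, P j & \sum_k a j k * x k = 0) ->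
  lebesgue_null A.
Proof.
move=> aN0 AP.
exists (hyperplanes P (fun j i => a j (enum_val i)) (fun=> 0)); split.
- exact: measurable_hyperplanes.
- apply: lebesgue_tuple_hyperplanes => j /aN0[k ak].
  by exists (enum_rank k); rewrite enum_rankK.
- move=> t /= /AP[j Pj tj]; apply/existsP; exists j; rewrite Pj /=; apply/eqP.
  rewrite -[RHS]tj (reindex_onto enum_rank enum_val) => [|i _]; last exact: enum_valK.
  rewrite (eq_bigl predT) => [|k]; last by rewrite enum_rankK eqxx.
  by apply: eq_bigr => k _; rewrite enum_rankK.
Qed.

End NullSets.

(** * Optimal decisions along a segment *)

Section Switch.
Context (R : realType).

Lemma finite_pos_lower_bound (I : finType) (P : pred I) (x : I -> R) :
  (forall i, P i -> 0 < x i) ->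
  exists2 g : R, 0 < g & forall i, P i -> g <= x i.
Proof.
move=> x0; suff [g g0 gx] : exists2 g : R, 0 < g &
    forall i, i \in enum I -> P i -> g <= x i.
  by exists g => // i; apply: gx; rewrite mem_enum.
elim: (enum I) => [|j s [g g0 gx]]; first by exists 1.
exists (if P j then Num.min g (x j) else g) => [|i].
  by case: ifP => // Pj; rewrite lt_min g0 x0.
rewrite in_cons => /predU1P[-> Pj|/gx{}gx /gx gxi].
  by rewrite Pj ge_min lexx orbT.
by case: ifP => // _; rewrite ge_min gxi.
Qed.

Lemma finite_abs_bound (I : finType) (x : I -> R) :
  exists2 C : R, 0 <= C & forall i, - C <= x i <= C.
Proof.
exists (\sum_i `|x i|) => [|i]; first exact: sumr_ge0.
by rewrite -ler_norml (bigD1 i) //= lerDl sumr_ge0.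
Qed.

(* Along the segment from [p1] to [p2], perturbed by [e v] and by [e v'], the
   difference of the two maximal values is [e * (v d - v' d)] at a common
   maximiser [d]: it is continuous and takes finitely many values. *)
Lemma common_maximisers_difference (T : finType) (p1 p2 v v' : T -> R) (a b : T) :
  (forall d, d != a -> p1 d < p1 a) ->
  (forall d, d != b -> p2 d < p2 b) ->
  (forall w1 w2 w3 : R, 0 <= w1 -> 0 <= w2 -> 0 <= w3 -> w1 + w2 + w3 = 1 ->
    exists d, forall d',
      (w1 * p1 d' + w2 * p2 d' + w3 * v d' <= w1 * p1 d + w2 * p2 d + w3 * v d) /\
      (w1 * p1 d' + w2 * p2 d' + w3 * v' d' <= w1 * p1 d + w2 * p2 d + w3 * v' d)) ->
  v a - v b = v' a - v' b.
Proof.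
move=> p1a p2b common.
have [g1 g10 g1P] : exists2 g : R, 0 < g & forall d, d != a -> g <= p1 a - p1 d.
  by apply: finite_pos_lower_bound => d /p1a; rewrite subr_gt0.
have [g2 g20 g2P] : exists2 g : R, 0 < g & forall d, d != b -> g <= p2 b - p2 d.
  by apply: finite_pos_lower_bound => d /p2b; rewrite subr_gt0.
have [B B0 vB] := finite_abs_bound v.
have [B' B'0 v'B] := finite_abs_bound v'.
have [C C0 CP] := finite_abs_bound (fun d => p2 d - p1 d).
pose D d := v d - v' d.
(* [D] takes finitely many values, so distinct ones are at least some [h] apart. *)
have [h h0 hP] : exists2 h : R, 0 < h &
    forall ij : T * T, D ij.1 != D ij.2 -> h <= `|D ij.1 - D ij.2|.
  by apply: finite_pos_lower_bound => ij; rewrite normr_gt0 subr_eq0.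
pose g := Num.min g1 g2.
have g0 : 0 < g by rewrite lt_min g10.
(* With [e = g / Q] the perturbations are too small to displace the strict maximisers [a] and [b] at
   the two ends. *)
pose Q := g + 2 * (B + B') + 1.
have Q0 : 0 < Q by rewrite /Q; lra.
pose e : R := g / Q.
have e0 : 0 < e by rewrite divr_gt0.
have eQ : e * Q = g by rewrite /e mulfVK// gt_eqF.
have e1 : e < 1 by rewrite ltr_pdivrMr// mul1r /Q; lra.
have eg : e * (2 * (B + B')) < (1 - e) * g by move: eQ; rewrite /Q; nra.
(* A step of length [1 / n] changes the comparison of two decisions by at most [2 * C / n], which
   has to stay below [e * h]. *)
have [n n0 nP] : exists2 n : nat, (0 < n)%N & 2 * C < e * h * n%:R.
  have x0 : 0 <= 2 * C / (e * h) by apply: divr_ge0; apply: mulr_ge0; lra.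
  exists (Num.bound (2 * C / (e * h))).+1; first by [].
  rewrite [e * h * _]mulrC -ltr_pdivrMr ?(mulr_gt0 e0 h0)//.
  by rewrite (lt_trans (archi_boundP x0))// ltr_nat.
pose W (u : T -> R) t d := (1 - e) * (1 - t) * p1 d + (1 - e) * t * p2 d + e * u d.
pose opt k d := forall d', W v (k%:R / n%:R) d' <= W v (k%:R / n%:R) d /\
                      W v' (k%:R / n%:R) d' <= W v' (k%:R / n%:R) d.
have n0' : 0 < n%:R :> R by rewrite ltr0n.
have optE k : (k <= n)%N -> exists d, opt k d.
  move=> kn; have t0 : 0 <= (k%:R / n%:R : R) by rewrite divr_ge0 ?ler0n.
  have t1 : k%:R / n%:R <= 1 :> R by rewrite ler_pdivrMr// mul1r ler_nat.
  by apply: common; [apply: mulr_ge0; lra|apply: mulr_ge0; lra|lra|ring].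
have opt0 d : opt 0 d -> d = a.
  move=> /(_ a)[/= oa _]; apply/eqP; apply: contraTT oa => da.
  rewrite -ltNge /W mul0r.
  move: (vB d) (vB a) (g1P _ da) (g1P _ da) => /andP[? ?] /andP[? ?] ? gd.
  have : (1 - e) * g <= (1 - e) * (p1 a - p1 d).
    by apply: ler_wpM2l; [lra|apply: le_trans gd; rewrite ge_min lexx].
  have : e * (v d - v a) <= e * (2 * (B + B')) by apply: ler_wpM2l; lra.
  lra.
have optn d : opt n d -> d = b.
  move=> /(_ b)[/= ob _]; apply/eqP; apply: contraTT ob => db.
  rewrite -ltNge /W divff ?gt_eqF//.
  move: (vB d) (vB b) (g2P _ db) (g2P _ db) => /andP[? ?] /andP[? ?] ? gd.
  have : (1 - e) * g <= (1 - e) * (p2 b - p2 d).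
    by apply: ler_wpM2l; [lra|apply: le_trans gd; rewrite ge_min lexx orbT].
  have : e * (v d - v b) <= e * (2 * (B + B')) by apply: ler_wpM2l; lra.
  lra.
(* Common maximisers [d'] and [d] at consecutive grid points satisfy
   [e * |D d - D d'| <= 2 * C / n < e * h], so [D] cannot jump. *)
have const k : (k <= n)%N -> forall d, opt k d -> D d = D a.
  elim: k => [_ d /opt0 -> //|k IHk kn d od].
  have [d' od'] := optE _ (ltnW kn); rewrite -(IHk (ltnW kn) _ od').
  have [//|Ddd'] := eqVneq (D d) (D d').
  have := hP (d, d') Ddd'; rewrite /= leNgt => /negP[].
  pose c := C / n%:R.
  have diff x : - c <= (1 - e) * ((p2 x - p1 x) / n%:R) <= c.
    have q0 : 0 <= n%:R^-1 :> R by rewrite invr_ge0 ltW.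
    have /andP[l u] := CP x.
    have lc : - c <= (p2 x - p1 x) / n%:R by rewrite /c -mulNr ler_wpM2r.
    have uc : (p2 x - p1 x) / n%:R <= c by rewrite /c ler_wpM2r.
    have c0 : 0 <= c by rewrite mulr_ge0.
    by apply/andP; split; nra.
  have Wk u x : W u (k.+1%:R / n%:R) x =
      W u (k%:R / n%:R) x + (1 - e) * ((p2 x - p1 x) / n%:R).
    by rewrite /W -natr1; field; rewrite gt_eqF.
  have := diff d; have := diff d'; move=> /andP[? ?] /andP[? ?].
  have c2 : 2 * c < e * h by rewrite /c mulrA ltr_pdivrMr.
  rewrite -(ltr_pM2l e0) -{1}(gtr0_norm e0) -normrM.
  apply: le_lt_trans c2; rewrite ler_norml.
  have WD x t : W v t x - W v' t x = e * D x by rewrite /W /D; ring.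
  rewrite mulrBr -!(WD _ (k%:R / n%:R)).
  move: (od d') (od' d); rewrite !Wk => -[? ?] [? ?].
  by apply/andP; split; lra.
have [d od] := optE n (leqnn n).
have := const n (leqnn n) _ od; rewrite (optn _ od) /D; lra.
Qed.

End Switch.

(** * Outcomes and marginalisation *)

Section Outcomes.
Context (R : realType) (N : nat) (dom : 'I_N -> finType) (act : finType).
Local Notation outcome := (outcome dom act).
Local Notation vdom := (vdom dom act).

Implicit Types (c : outcome) (v w : var N).

Definition upd (c : outcome) (v : var N) (y : vdom v) : outcome :=
  [ffun w => dfwith c v y w].
Arguments upd : clear implicits.

Definition supported (T : Type) (S : {set var N}) (F : outcome -> T) :=
  forall c c' : outcome, (forall v, v \in S -> c v = c' v) -> F c = F c'.

Lemma upd_same c v y : upd c v y v = y.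
Proof. by rewrite ffunE dfwithin. Qed.

Lemma upd_other c v y w : w != v -> upd c v y w = c w.
Proof. by move=> wv; rewrite ffunE dfwithout// eq_sym. Qed.

Lemma upd_id (c c' : outcome) v : (forall w, w != v -> c' w = c w) ->
  upd c v (c' v) = c'.
Proof.
move=> cc'; apply/ffunP => w; have [->|wv] := eqVneq w v.
  by rewrite upd_same.
by rewrite upd_other// cc'.
Qed.

Lemma updC c v w y z : v != w -> upd (upd c v y) w z = upd (upd c w z) v y.
Proof.
move=> vw; apply/ffunP => x; have [->|xw] := eqVneq x w.
  by rewrite upd_same upd_other 1?eq_sym// upd_same.
rewrite upd_other//; have [->|xv] := eqVneq x v; first by rewrite !upd_same.
by rewrite !upd_other.
Qed.

Lemma supported_upd T S (F : outcome -> T) c v y :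
  supported S F -> v \notin S -> F (upd c v y) = F c.
Proof.
move=> SF vS; apply: SF => w wS; rewrite upd_other//.
by apply: contraNneq vS => <-.
Qed.

(** Exchanging the state of [v] in [c] with the new state [y] is an involution on the pairs
    [(c, y)]. *)
Lemma sum_upd (F : outcome -> R) v :
  \sum_c \sum_(y : vdom v) F (upd c v y) = #|vdom v|%:R * \sum_c F c.
Proof.
pose h (p : outcome * vdom v) : outcome * vdom v := (upd p.1 v p.2, p.1 v).
have hK : involutive h.
  move=> [c y]; rewrite /h /= upd_same; congr (_, _).
  by apply: upd_id => w wv; rewrite upd_other.
transitivity (\sum_c \sum_(y : vdom v) F c).
  rewrite !pair_bigA /= [RHS](reindex_inj (inv_inj hK)) /=.
  by apply: eq_bigr => -[].
by rewrite mulr_sumr; apply: eq_bigr => c _; rewrite sumr_const mulr_natl.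
Qed.

(** Summing over the state of [v] first turns either factor into 1; [sum_upd] allows this at the
    price of a factor [#|vdom v|], nonzero once an outcome exists. *)
Lemma swap_factor v (F f g : outcome -> R) :
  supported (~: [set v]) F ->
  (forall c, \sum_(y : vdom v) f (upd c v y) = 1) ->
  (forall c, \sum_(y : vdom v) g (upd c v y) = 1) ->
  \sum_c F c * f c = \sum_c F c * g c.
Proof.
move=> SF f1 g1; case: (pickP {: outcome}) => [c0 _|no]; last first.
  by rewrite !big1 // => c; have := no c.
have v0 : #|vdom v|%:R != 0 :> R.
  by rewrite pnatr_eq0 -lt0n; apply/card_gt0P; exists (c0 v).
apply: (mulfI v0); rewrite -!sum_upd; apply: eq_bigr => c _.
have E (k : outcome -> R) : (forall c, \sum_(y : vdom v) k (upd c v y) = 1) ->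
    \sum_(y : vdom v) F (upd c v y) * k (upd c v y) = F c.
  move=> k1; rewrite -[RHS]mulr1 -(k1 c) mulr_sumr; apply: eq_bigr => y _.
  by rewrite (supported_upd _ _ SF)// !inE eqxx.
by rewrite !E.
Qed.

(* The factors outside [A] are replaced by point masses one by one, always at a
   variable all of whose children are in place already. *)
Lemma sum_out (rk : var N -> nat) (pa : var N -> {set var N}) (A : {set var N})
    (f : var N -> outcome -> R) (F : outcome -> R) (p : outcome) :
  (forall v w, v \in pa w -> (rk v < rk w)%N) ->
  (forall w, w \in A -> pa w \subset A) ->
  (forall w, supported (w |: pa w) (f w)) ->
  (forall w, w \notin A -> forall c, \sum_(y : vdom w) f w (upd c w y) = 1) ->
  supported A F ->
  \sum_c F c * \prod_v f v c =
  \sum_c F c * \prod_v (if v \in A then f v c else (c v == p v)%:R).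
Proof.
move=> rkP paA Sf f1 SF.
pose h (S : {set var N}) v c := if v \in S then (c v == p v)%:R else f v c.
suff H n (S : {set var N}) : (#|~: (A :|: S)| <= n)%N -> S \subset ~: A ->
    \sum_c F c * \prod_v h S v c = \sum_c F c * \prod_v h (~: A)%SET v c.
  transitivity (\sum_c F c * \prod_v h (~: A)%SET v c).
    rewrite -(H _ finset.set0 (leqnn _) (finset.sub0set _)); apply: eq_bigr => c _.
    by congr (_ * _); apply: eq_bigr => v _; rewrite /h inE.
  apply: eq_bigr => c _; congr (_ * _); apply: eq_bigr => v _.
  by rewrite /h finset.in_setC; case: (v \in A).
elim: n S => [|n IHn] S.
  rewrite leqn0 cards_eq0 => /eqP S0 SA; suff -> : S = (~: A)%SET by [].
  apply/eqP; rewrite finset.eqEsubset SA /=; apply/fintype.subsetP => v.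
  move/setP: S0 => /(_ v); rewrite !inE negb_or => /negbT.
  by rewrite negb_and !negbK => /orP[->|].
have [->|SA'] := eqVneq S (~: A)%SET; first by [].
move=> cS SA.
have [v0 v0P] : exists v, v \in ~: (A :|: S).
  apply/set0Pn; apply: contraNneq SA' => S0.
  rewrite finset.eqEsubset SA /=; apply/fintype.subsetP => v.
  move/setP: S0 => /(_ v); rewrite !inE negb_or => /negbT.
  by rewrite negb_and !negbK => /orP[->|].
(* A child of [v] has larger rank and is not in [A], which is closed under parents; by maximality it
   lies in [S]. *)
case: (arg_maxnP rk v0P) => v vAS vmax.
have /andP[vA vS] : (v \notin A) && (v \notin S).
  by rewrite -negb_or -finset.in_setU -finset.in_setC.
rewrite -(IHn (v |: S)); last 2 first.
- rewrite -ltnS; apply: leq_trans cS; apply: proper_card.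
  apply/properP; split; first by rewrite finset.setCS finset.setUS // finset.subsetUr.
  by exists v => //; rewrite !inE eqxx orbT.
- by apply/fintype.subsetP => w /setU1P[->|/(fintype.subsetP SA)//]; rewrite inE.
pose rest c := F c * \prod_(w | w != v) h S w c.
transitivity (\sum_c rest c * f v c).
  apply: eq_bigr => c _; rewrite (bigD1 v) //= mulrCA mulrC /rest /h.
  by rewrite (negbTE vS).
transitivity (\sum_c rest c * (c v == p v)%:R); last first.
  apply: eq_bigr => c _; rewrite (bigD1 v) //= mulrCA mulrC /rest.
  have -> : h (v |: S) v c = (c v == p v)%:R by rewrite /h finset.setU11.
  congr (_ * (_ * _)); apply: eq_bigr => w wv.
  by rewrite /h finset.in_setU1 (negbTE wv).
apply: (@swap_factor v) => [c c' cc'| |c]; [|exact: f1|].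
- have cc w : w != v -> c w = c' w by move=> wv; apply: cc'; rewrite !inE.
  rewrite /rest; congr (_ * _).
    by apply: SF => w wA; apply: cc; apply: contraTneq wA => ->.
  apply: eq_bigr => w wv; rewrite /h; case: ifP => wS; first by rewrite cc.
  apply: Sf => x /setU1P[->|xw]; first exact: cc.
  apply: cc; apply: contraTneq xw => ->; apply/negP => vw.
  have [wA|wA] := boolP (w \in A).
    by move: (paA _ wA) => /fintype.subsetP/(_ _ vw); apply/negP.
  have /vmax : w \in ~: (A :|: S) by rewrite finset.in_setC finset.in_setU negb_or wA wS.
  by rewrite /= leqNgt rkP.
- rewrite (bigD1 (p v)) //= upd_same eqxx big1 ?addr0// => y yp.
  by rewrite upd_same (negbTE yp).
Qed.

End Outcomes.
Arguments upd {N dom act} c v y.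

(** * Values of decisions under local interventions *)

Section Values.
Context (R : realType) (N : nat) (dom : 'I_N -> finType) (act : finType).
Local Notation outcome := (outcome dom act).
Local Notation vdom := (vdom dom act).
Local Notation proj := Defs.proj.
Implicit Types (c r : outcome) (v w : var N) (m : {set var N}).

(* Probability tables over whole outcomes, rather than configurations of the
   parents, so that the tables of worlds with different graphs can be compared. *)
Definition table := forall i, outcome -> dom i -> R.
Definition local_maps : finType := {dffun forall i : 'I_N, {ffun dom i -> dom i}}.
Implicit Types (K : table) (f : local_maps) (u : outcome -> R).

Definition weight K c := \prod_i K i c (c (Some i)).

Definition localize K f : table :=
  fun i c y => \sum_(y' | f i y' == y) K i c y'.

Arguments localize : clear implicits.

Definition stochastic K := forall i, is_kernel (K i).

Definition agree (m : {set var N}) c r := [forall v in m, c v == r v].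

(* Expected utility of the decision [d] in the domain [f], restricted to the
   event (not conditioned on it) that the inputs in [m] take their values in [r]. *)
Definition value K u m r f d :=
  \sum_(c | agree m c r && (c None == d)) weight (localize K f) c * u c.

Definition set_map f i (g : {ffun dom i -> dom i}) : local_maps :=
  [ffun j => dfwith f i g j].
Arguments set_map : clear implicits.

Definition const_map i (x : dom i) : {ffun dom i -> dom i} := [ffun=> x].
Definition two_valued i (y x1 x0 : dom i) : {ffun dom i -> dom i} :=
  [ffun y' => if y' == y then x1 else x0].

Lemma set_map_same f i g : set_map f i g i = g.
Proof. by rewrite ffunE dfwithin. Qed.

Lemma set_map_other f i g j : j != i -> set_map f i g j = f j.
Proof. by move=> ji; rewrite ffunE dfwithout// eq_sym. Qed.

Lemma agreeP m c r : reflect (forall v, v \in m -> c v = r v) (agree m c r).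
Proof.
by apply: (iffP forall_inP) => H v vm; [exact/eqP/H|exact/eqP/H].
Qed.

Lemma localize_const K f i x : stochastic K -> f i = const_map x ->
  forall c y, localize K f i c y = (y == x)%:R.
Proof.
move=> Kk fi c y; rewrite /localize fi.
have [->|yx] := eqVneq y x.
  by rewrite -[RHS](Kk i c).2; apply: eq_bigl => y'; rewrite ffunE eqxx.
by rewrite big1// => y'; rewrite ffunE eq_sym (negbTE yx).
Qed.

(** Among the outcomes with decision [d] only [upd c0 None d] has nonzero weight, and its weight is
    1. *)
Lemma value_hard K u m r f c0 d : stochastic K -> None \notin m ->
  (forall i, f i = const_map (c0 (Some i))) ->
  value K u m r f d = if agree m c0 r then u (upd c0 None d) else 0.
Proof.
move=> Kk mN fc.
have W0 c : weight (localize K f) c = \prod_i (c (Some i) == c0 (Some i))%:R.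
  by apply: eq_bigr => i _; rewrite (localize_const Kk (fc i)).
have agE : agree m (upd c0 None d) r = agree m c0 r.
  by apply: eq_forallb_in => v vm; rewrite upd_other//; apply: contraNneq mN => <-.
rewrite /value big_mkcond (bigD1 (upd c0 None d)) //= upd_same eqxx andbT agE.
rewrite W0 big1 ?mul1r => [|i _]; last by rewrite upd_other// eqxx.
rewrite big1 ?addr0// => c cc0; case: ifP => // /andP[_ /eqP cd].
have [i ci] : exists i, c (Some i) != c0 (Some i).
  apply/existsP; apply: contraNT cc0; rewrite negb_exists => /forallP cc0.
  apply/eqP; rewrite -cd; symmetry; apply: upd_id => -[i|//] _.
  exact/eqP/negPn/cc0.
by rewrite W0 (bigD1 i) //= (negbTE ci) !mul0r.
Qed.

(** Conditioning on the state [y] of [i] before [f i] acts. Hard interventions hold the variables in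
    [S] at [c], so [y] has probability [K i c y]. *)
Lemma value_step K u m r f d i c (S : {set var N}) : stochastic K ->
  supported S (K i) -> None \notin S -> Some i \notin S ->
  (forall j, Some j \in S -> f j = const_map (c (Some j))) ->
  value K u m r f d =
  \sum_y K i c y * value K u m r (set_map f i (const_map (f i y))) d.
Proof.
move=> Kk SK SN Si fS.
under eq_bigr do rewrite /value mulr_sumr.
rewrite exchange_big; apply: eq_bigr => c' _ /=.
under eq_bigr do rewrite mulrA.
rewrite -mulr_suml; congr (_ * _).
pose rest := \prod_(j | j != i) localize K f j c' (c' (Some j)).
transitivity (localize K f i c' (c' (Some i)) * rest).
  by rewrite /weight (bigD1 i).
transitivity (\sum_y K i c y * ((c' (Some i) == f i y)%:R * rest)); last first.
  apply: eq_bigr => y _; rewrite /weight (bigD1 i) //=; congr (_ * (_ * _)).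
    by rewrite (@localize_const _ _ _ (f i y)) ?set_map_same.
  by apply: eq_bigr => j ji; rewrite /localize set_map_other.
under eq_bigr do rewrite mulrA; rewrite -mulr_suml.
(* If the other factors do not vanish, [c'] agrees with [c] on [S], and [K i c'] is [K i c]. *)
have [->|rest0] := eqVneq rest 0; first by rewrite !mulr0.
congr (_ * _); rewrite /localize big_mkcond; apply: eq_bigr => y _.
rewrite [in RHS]eq_sym; case: eqP => _; rewrite ?mulr1 ?mulr0//.
rewrite (SK c' c) // => -[j|] jS; last by rewrite jS in SN.
have ji : j != i by apply: contraNneq Si => <-.
apply/eqP; apply: contra_neqT rest0 => cj.
by rewrite /rest (bigD1 j) //= (localize_const Kk (fS _ jS)) (negbTE cj) mul0r.
Qed.

End Values.
Arguments set_map {N dom} f i g.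
Arguments localize {R N dom act} K f i c y.

(** * Optimal policies in mixtures with a common mask *)

Section Optimality.
Context (R : realType) (N : nat) (dom : 'I_N -> finType) (act : finType).
Context (PaD : {set var N}).
Local Notation outcome := (outcome dom act).
Local Notation vdom := (vdom dom act).
Local Notation proj := Defs.proj.
Local Notation table := (table R dom act).
Local Notation policy := (policy R dom act PaD).
Local Notation mixture := (mixture R dom PaD).
Implicit Types (c r : outcome) (v w : var N) (m : {set var N}).
Implicit Types (K : table) (f : local_maps dom) (u : outcome -> R).
Implicit Types (sigma : mixture) (rho : policy).

(** Convertible to [expected_utility] of [mixture_joint] when [K] and [u] are read off
    configurations, so that optimality carries over as it is. *)
Definition payoff K u sigma rho :=
  \sum_c (\sum_s sval sigma s *
    (weight (localize K s.1) c * rho (proj PaD c) (c None))) * u c.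

Definition allowed sigma rho :=
  is_kernel rho /\ forall s, 0 < sval sigma s -> depends_only_on (val s.2) rho.

Lemma distribution_support (T : finType) (q : T -> R) :
  (forall x, 0 <= q x) -> \sum_x q x = 1 -> exists x, 0 < q x.
Proof.
move=> q0 q1; apply: contrapT => no; move: q1; rewrite big1 => [/esym/eqP|x _].
  by rewrite oner_eq0.
by apply/eqP; rewrite eq_le q0 andbT leNgt; apply/negP => ?; apply: no; exists x.
Qed.

Lemma depends_only_onP m rho : m \subset PaD -> depends_only_on m rho ->
  forall c c', agree m c c' -> rho (proj PaD c) = rho (proj PaD c').
Proof.
move=> mP rm c c' /agreeP cc'; apply: rm => v vm.
by rewrite !ffunE; exact: cc'.
Qed.

Lemma payoff_split K u sigma rho m r : m \subset PaD -> depends_only_on m rho ->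
  payoff K u sigma rho =
  \sum_d rho (proj PaD r) d * (\sum_s sval sigma s * value K u m r s.1 d) +
  \sum_(c | ~~ agree m c r) (\sum_s sval sigma s *
    (weight (localize K s.1) c * rho (proj PaD c) (c None))) * u c.
Proof.
move=> mP rm; rewrite /payoff (bigID (fun c => agree m c r)) /=; congr (_ + _).
rewrite (partition_big (fun c : outcome => c None) predT) //=.
apply: eq_bigr => d _; rewrite mulr_sumr.
under [RHS]eq_bigr do rewrite /value !mulr_sumr.
rewrite exchange_big /=; apply: eq_bigr => c /andP[cr /eqP cd].
rewrite mulr_suml; apply: eq_bigr => s _.
by rewrite (depends_only_onP mP rm cr) cd; ring.
Qed.

(** An exchange argument: playing a best decision [dm] exactly where the visible inputs agree with
    [r] gives an allowed policy and changes only the first sum of [payoff_split]. *)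
Lemma masked_optimum K u sigma rho m r : m \subset PaD ->
  (forall s, 0 < sval sigma s -> val s.2 = m) ->
  maximises (allowed sigma) (payoff K u sigma) rho ->
  forall d, 0 < rho (proj PaD r) d ->
  forall d', \sum_s sval sigma s * value K u m r s.1 d' <=
             \sum_s sval sigma s * value K u m r s.1 d.
Proof.
move=> mP sm [[rk rs] ropt].
have rm : depends_only_on m rho.
  have [p0 p1] := svalP sigma; have [s ps] := distribution_support p0 p1.
  by rewrite -(sm _ ps); exact: rs.
move=> d qd; set q := rho (proj PaD r); have [q0 q1] : (forall d, 0 <= q d) /\ \sum_d q d = 1.
  exact: rk.
pose W d := \sum_s sval sigma s * value K u m r s.1 d.
pose dm := [arg max_(d' > d) W d']%O.
have dmP d' : W d' <= W dm by rewrite /dm; case: arg_maxP => // i _; apply.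
pose fits (x : config dom act PaD) :=
  [forall v, (val v \in m) ==> (x v == proj PaD r v)].
pose rho' : policy := fun x d => if fits x then (d == dm)%:R else rho x d.
have fitsE c : fits (proj PaD c) = agree m c r.
  apply/forallP/agreeP => [H v vm|H v].
    have vP : v \in PaD by move/fintype.subsetP: mP; apply.
    by have /implyP/(_ vm) := H (Sub v vP); rewrite !ffunE => /eqP.
  by apply/implyP => vm; rewrite !ffunE H.
have r'm : depends_only_on m rho'.
  move=> x y xy; rewrite /rho'.
  have -> : fits x = fits y.
    apply: eq_forallb => v; case: (boolP (val v \in m)) => //= vm.
    by rewrite xy.
  by apply/funext => d1; case: ifP => // _; rewrite (rm _ _ xy).
have allow' : allowed sigma rho'.
  split=> [x|s /sm ->//]; rewrite /rho'; case: (fits x); last exact: rk.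
  split=> [d1|]; first by rewrite ler0n.
  by rewrite (bigD1 dm) //= eqxx big1 ?addr0// => d1 /negbTE ->.
have := ropt _ allow'; rewrite !(payoff_split _ _ _ r mP)//.
have -> : \sum_(c | ~~ agree m c r) (\sum_s sval sigma s *
      (weight (localize K s.1) c * rho' (proj PaD c) (c None))) * u c =
    \sum_(c | ~~ agree m c r) (\sum_s sval sigma s *
      (weight (localize K s.1) c * rho (proj PaD c) (c None))) * u c.
  by apply: eq_bigr => c /negbTE cr; rewrite /rho' fitsE cr.
rewrite lerD2r -/q.
have -> : \sum_d rho' (proj PaD r) d * W d = W dm.
  have nr : fits (proj PaD r) by rewrite fitsE; apply/agreeP.
  rewrite (bigD1 dm) //= /rho' nr eqxx mul1r big1 ?addr0// => d1 /negbTE ->.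
  by rewrite mul0r.
(* The average loss against [dm] is zero, so each decision of positive weight has loss zero. *)
move=> Wle; have := q1; have : \sum_d q d * (W dm - W d) = 0.
  apply/eqP; rewrite eq_le sumr_ge0 ?andbT => [|d1 _]; last first.
    by rewrite mulr_ge0// subr_ge0.
  under eq_bigr do rewrite mulrBr.
  by rewrite sumrB -mulr_suml q1 mul1r subr_le0.
move=> /eqP; rewrite psumr_eq0 => [/allP sq _|d1 _]; last first.
  by rewrite mulr_ge0// subr_ge0.
move=> d'; apply: le_trans (dmP d') _.
have := sq d (mem_index_enum d); rewrite mulf_eq0 gt_eqF//= subr_eq0.
by move=> /eqP ->.
Qed.

End Optimality.

(** * Identification *)

Section Worlds.
Context (R : realType) (N : nat) (dom : 'I_N -> finType) (act : finType).
Context (PaU PaD : {set var N}).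
Local Notation outcome := (outcome dom act).
Local Notation vdom := (vdom dom act).
Local Notation proj := Defs.proj.
Local Notation table := (table R dom act).
Local Notation policy := (policy R dom act PaD).
Local Notation mixture := (mixture R dom PaD).
Implicit Types (c r : outcome) (v w : var N) (m : {set var N}).
Implicit Types (K : table) (f : local_maps dom) (u : outcome -> R).
Implicit Types (sigma : mixture) (rho : policy) (B : {set 'I_N}).
Implicit Types (G : {set node N * node N}).

(** [gu_decision] and [gu_undominated] will come from domain dependence; [gu_decisions] and
    [gu_chance] exclude linear relations between utility values. *)
Record generic_utility u : Prop := GenericUtility {
  gu_local : supported PaU u;
  gu_decision : None \in PaU;
  gu_decisions : forall c d d', d != d' -> u (upd c None d) != u (upd c None d');
  gu_chance : forall c i (x x' : dom i) d d', Some i \in PaU -> x != x' -> d != d' ->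
    u (upd (upd c (Some i) x) None d) - u (upd (upd c (Some i) x) None d') !=
    u (upd (upd c (Some i) x') None d) - u (upd (upd c (Some i) x') None d');
  gu_undominated : forall d, exists c d', u (upd c None d) < u (upd c None d')
}.

(** In [w_generic] one state [y] of the child serves all states of the other variables, because it
    determines the local map used on the child. *)
Record world u (family : mixture -> policy) G K : Prop := World {
  w_graph : cid_graph G;
  w_unmediated : unmediated G;
  w_PaU : Pa G nodeU = PaU;
  w_PaD : Pa G nodeD = PaD;
  w_stochastic : stochastic K;
  w_local : forall i, supported (Pa G (chance i)) (K i);
  w_generic : forall i j, edge G (chance i) (chance j) -> exists y,
    forall c (x x' : dom i), x != x' ->
    K j (upd c (Some i) x) y != K j (upd c (Some i) x') y;
  w_optimal : forall sigma,
    maximises (allowed sigma) (payoff K u sigma) (family sigma)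
}.

(** Despite the name, these inputs stay visible: as second component of a local intervention, the
    set hides the inputs in [PaU]. Visible inputs are then no arguments of the utility, and hard
    interventions can give them any states without changing it. *)
Definition masked := (PaD :\: PaU)%SET.

Lemma masked_sub : masked \subset PaD.
Proof. exact: finset.subsetDl. Qed.

Lemma mixture_of_three (s1 s2 s3 : local_intervention dom PaD) (w1 w2 w3 : R) :
  0 <= w1 -> 0 <= w2 -> 0 <= w3 -> w1 + w2 + w3 = 1 ->
  exists sigma : mixture,
    (forall s, 0 < sval sigma s -> [\/ s = s1, s = s2 | s = s3]) /\
    forall F : local_intervention dom PaD -> R,
      \sum_s sval sigma s * F s = w1 * F s1 + w2 * F s2 + w3 * F s3.
Proof.
move=> w10 w20 w30 w1E.
pose p s := w1 * (s == s1)%:R + w2 * (s == s2)%:R + w3 * (s == s3)%:R.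
have pF (F : local_intervention dom PaD -> R) :
    \sum_s p s * F s = w1 * F s1 + w2 * F s2 + w3 * F s3.
  have one t : \sum_s (s == t)%:R * F s = F t.
    rewrite (bigD1 t) //= eqxx mul1r big1 ?addr0// => s /negbTE ->.
    by rewrite mul0r.
  rewrite -!one !mulr_sumr -!big_split /=; apply: eq_bigr => s _.
  by rewrite /p !mulrDl !mulrA.
have p1 : \sum_s p s = 1.
  have := pF (fun=> 1); under eq_bigr do rewrite mulr1.
  by rewrite !mulr1 w1E.
have p0 s : 0 <= p s by rewrite !addr_ge0 ?mulr_ge0 ?ler0n.
exists (exist _ p (conj p0 p1)); split=> //= s; rewrite /p.
have [->|_] := eqVneq s s1; first by constructor 1.
have [->|_] := eqVneq s s2; first by constructor 2.
have [->|_] := eqVneq s s3; first by constructor 3.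
by rewrite !mulr0 !addr0 ltxx.
Qed.

(** * Comparison of two worlds with the same optimal policies *)

Section TwoWorlds.
Context (u : outcome -> R) (family : mixture -> policy).
Context (G G' : {set node N * node N}) (K K' : table) (a b : act) (c1 c2 : outcome).
Arguments K : clear implicits.
Arguments K' : clear implicits.
Hypothesis (gu : generic_utility u).
Hypothesis (W : world u family G K) (W' : world u family G' K').
Hypothesis (ab : a != b).
Hypothesis (best1 : forall d, d != a -> u (upd c1 None d) < u (upd c1 None a)).
Hypothesis (best2 : forall d, d != b -> u (upd c2 None d) < u (upd c2 None b)).

Definition gap K0 r f :=
  value K0 u masked r f a - value K0 u masked r f b.

Lemma None_PaD G0 K0 : world u family G0 K0 -> None \notin PaD.
Proof.
move=> W0; rewrite -(w_PaD W0) inE; have [acy _] := w_graph W0.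
by apply/negP => DD; move: (acy _ _ DD); rewrite (connect1 DD).
Qed.

Lemma None_masked : None \notin masked.
Proof. by rewrite finset.in_setD negb_and (None_PaD W) orbT. Qed.

(** A decision played at [r] by the common family is best in both worlds, for every mixture of [f]
    with two hard interventions whose values do not depend on the world. *)
Lemma gap_identified r f : gap K r f = gap K' r f.
Proof.
(* Setting the visible inputs to [r] makes the event in [value] certain and preserves the
   utility. *)
pose over c : outcome := [ffun v => if v \in masked then r v else c v].
pose hard c : local_maps dom := [ffun i => const_map (c (Some i))].
have uover c d : u (upd (over c) None d) = u (upd c None d).
  apply: (gu_local gu) => v vU; have [->|vN] := eqVneq v None.
    by rewrite !upd_same.
  by rewrite !upd_other// ffunE finset.in_setD vU.
have aover c : agree masked (over c) r.
  by apply/agreeP => v vm; rewrite ffunE vm.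
have vhard K0 c d : stochastic K0 ->
    value K0 u masked r (hard (over c)) d = u (upd c None d).
  move=> st; rewrite (value_hard _ _ _ st None_masked (c0 := over c)) => [|i].
    by rewrite aover uover.
  by rewrite ffunE.
rewrite /gap; apply: (common_maximisers_difference
  (v := value K u masked r f) (v' := value K' u masked r f) best1 best2).
move=> w1 w2 w3 w10 w20 w30 w1E.
pose mask : {m : {set var N} | m \subset PaD} := Sub masked masked_sub.
have [sigma [supp sumE]] := mixture_of_three (hard (over c1), mask)
  (hard (over c2), mask) (f, mask) w10 w20 w30 w1E.
have maskE s : 0 < sval sigma s -> val s.2 = masked by move=> /supp[] ->.
have [[rk _] _] := w_optimal W sigma.
have [rk0 rk1] := rk (proj PaD r); have [d pd] := distribution_support rk0 rk1.
have dP := masked_optimum masked_sub maskE (w_optimal W sigma) pd.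
have d'P := masked_optimum masked_sub maskE (w_optimal W' sigma) pd.
exists d => d'; move: (dP d') (d'P d'); rewrite !sumE /=.
by rewrite !(vhard _ _ _ (w_stochastic W)) !(vhard _ _ _ (w_stochastic W')).
Qed.

Definition pin (B : {set 'I_N}) f c : local_maps dom :=
  [ffun i => if i \in B then f i else const_map (c (Some i))].

Lemma pin_upd B f c i (x : dom i) : i \notin B ->
  set_map (pin B f c) i (const_map x) = pin B f (upd c (Some i) x).
Proof.
move=> iB; apply/ffunP => j; have [->|ji] := eqVneq j i.
  by rewrite set_map_same ffunE (negbTE iB) upd_same.
by rewrite set_map_other// ffunE [RHS]ffunE; case: ifP => // _; rewrite upd_other.
Qed.

Lemma pin_setU1 B f c i g :
  pin (i |: B) (set_map f i g) c = set_map (pin B f c) i g.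
Proof.
apply/ffunP => j; rewrite ffunE finset.in_setU1; have [->|ji] := eqVneq j i.
  by rewrite !set_map_same.
by rewrite !set_map_other// ffunE.
Qed.

(** By acyclicity no parent of [i] is [i] or lies in [B], so all are held at [c]; then [i] takes the
    state [x1] with probability [K0 i c y], and [x0] otherwise. *)
Lemma gap_two_valued G0 K0 B f c r i (y x1 x0 : dom i) : world u family G0 K0 ->
  None \notin Pa G0 (chance i) -> i \notin B ->
  (forall l, l \in B -> connect (edge G0) (chance i) (chance l)) ->
  gap K0 r (set_map (pin B f c) i (two_valued y x1 x0)) =
  K0 i c y * gap K0 r (pin B f (upd c (Some i) x1)) +
  (1 - K0 i c y) * gap K0 r (pin B f (upd c (Some i) x0)).
Proof.
move=> W0 iD iB Bi; have [acy _] := w_graph W0.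
have iPa : Some i \notin Pa G0 (chance i).
  by rewrite inE; apply/negP => /acy; rewrite connect0.
have fixed j : Some j \in Pa G0 (chance i) ->
    set_map (pin B f c) i (two_valued y x1 x0) j = const_map (c (Some j)).
  move=> jPa; rewrite set_map_other; last first.
    by apply: contraNneq iPa => ji; move: jPa; rewrite ji.
  rewrite ffunE; case: ifP => // /Bi ij.
  by move: jPa; rewrite inE => /acy; rewrite ij.
rewrite /gap !(value_step _ _ _ _ (w_stochastic W0) (w_local W0 (i := i)) iD iPa fixed).
rewrite -sumrB.
under eq_bigr => y' _ do rewrite -mulrBr.
have sm y' : set_map (set_map (pin B f c) i (two_valued y x1 x0)) i
    (const_map (set_map (pin B f c) i (two_valued y x1 x0) i y')) =
    pin B f (upd c (Some i) (if y' == y then x1 else x0)).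
  rewrite set_map_same -(pin_upd _ _ _ iB); apply/ffunP => j.
  have [->|ji] := eqVneq j i; first by rewrite !set_map_same ffunE.
  by rewrite !set_map_other.
under eq_bigr => y' _ do rewrite sm.
rewrite (bigD1 y) //= eqxx; congr (_ + _).
have -> : 1 - K0 i c y = \sum_(y' | y' != y) K0 i c y'.
  by rewrite -(w_stochastic W0 i c).2 (bigD1 y) //= addrAC subrr add0r.
rewrite mulr_suml.
by apply: eq_bigr => y' /negbTE ->.
Qed.

Definition terminal i := Some i \in PaU :|: PaD.

(** The index is the length of some path through chance variables; that it is shortest is expressed
    by excluding smaller indices. *)
Inductive reach G0 : nat -> 'I_N -> Prop :=
| reach_terminal i : terminal i -> reach G0 0 i
| reach_edge i j k : edge G0 (chance i) (chance j) -> reach G0 k j ->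
    reach G0 k.+1 i.

Definition upstream G0 i :=
  exists2 t, terminal t & connect (edge G0) (chance i) (chance t).

(* [i] influences the gap, in both worlds, through some nodes [B] downstream
   of [i] on which [f] acts, when all the other nodes are held fixed. *)
Definition influences k r i := exists (B : {set 'I_N}) f (x1 x0 : dom i),
  [/\ i \notin B,
      forall l, l \in B -> connect (edge G) (chance i) (chance l) /\
                          connect (edge G') (chance i) (chance l),
      forall c j x, (forall k', (k' <= k)%N -> ~ reach G k' j) ->
        gap K r (pin B f (upd c (Some j) x)) = gap K r (pin B f c) &
      forall c, (forall l, Some l \in masked -> l != i -> c (Some l) = r (Some l)) ->
        gap K r (pin B f (upd c (Some i) x1)) !=
        gap K r (pin B f (upd c (Some i) x0))].

(** An edge from [D] to [i] would close a cycle through a parent of [D], or make [i] a mediator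
    between [D] and [U]. *)
Lemma upstream_decision G0 K0 i : world u family G0 K0 -> upstream G0 i ->
  None \notin Pa G0 (chance i).
Proof.
move=> W0 [t]; rewrite /terminal finset.in_setU inE => tT it.
apply/negP => Di; have [acy _] := w_graph W0.
have Dt : connect (edge G0) nodeD (chance t) := connect_trans (connect1 Di) it.
case/orP: tT; last by rewrite -(w_PaD W0) inE => /acy/negP.
rewrite -(w_PaU W0) inE => tU.
have := w_unmediated W0 => /setP/(_ (chance i)); rewrite !inE /= (connect1 Di).
by rewrite (connect_trans it (connect1 tU)).
Qed.

(** Both entries solve one linear equation, whose coefficients are gaps and hence common to the two
    worlds, and whose slope [h1 - h0] is nonzero. *)
Lemma table_identified i : upstream G i -> upstream G' i ->
  (forall r, exists k, influences k r i) -> K i = K' i.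
Proof.
move=> up up' infl; apply/funext => c; apply/funext => y.
have [k [B [f [x1 [x0 [iB Bi _ eff]]]]]] := infl c.
have e := gap_two_valued f c c y x1 x0 W (upstream_decision W up) iB
  (fun l lB => (Bi l lB).1).
have e' := gap_two_valued f c c y x1 x0 W' (upstream_decision W' up') iB
  (fun l lB => (Bi l lB).2).
move: e; rewrite !gap_identified e' -!gap_identified.
(* Since [c] itself is the reference, the condition on the visible inputs is trivial. *)
have := eff c (fun _ _ _ => erefl).
set h1 := gap _ _ _; set h0 := gap _ _ _ => h10 e.
have : (K i c y - K' i c y) * (h1 - h0) = 0.
  by move/eqP: e; rewrite -subr_eq0 => /eqP e; rewrite -[RHS]oppr0 -e; ring.
move/eqP; rewrite mulf_eq0 !subr_eq0 => /orP[/eqP//|/eqP h1h0].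
by rewrite h1h0 eqxx in h10.
Qed.

Hypothesis hdom : forall i, (1 < #|dom i|)%N.

Lemma two_states i : exists x1 x0 : dom i, x1 != x0.
Proof. by have /card_gt1P[x [x' [_ _ xx']]] := hdom i; exists x, x'. Qed.

(** With all chance variables held fixed, the gap is a difference of two utilities, or zero if a
    visible input deviates from [r]. A parent of [U] alters this difference; a visible input
    switches it off. *)
Lemma terminal_influences i r : terminal i -> influences 0 r i.
Proof.
move=> Ti; pose f0 : local_maps dom := [ffun j => finfun id].
have gapE c : gap K r (pin finset.set0 f0 c) =
    if agree masked c r then u (upd c None a) - u (upd c None b) else 0.
  have fc j : pin finset.set0 f0 c j = const_map (c (Some j)).
    by rewrite ffunE finset.in_set0.
  rewrite /gap !(value_hard _ _ _ (w_stochastic W) None_masked fc).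
  by case: ifP => // _; rewrite subrr.
have indep c j x : (forall k', (k' <= 0)%N -> ~ reach G k' j) ->
    gap K r (pin finset.set0 f0 (upd c (Some j) x)) =
    gap K r (pin finset.set0 f0 c).
  move=> /(_ 0%N (leqnn _)) nr; rewrite !gapE.
  have nT : ~~ terminal j by apply/negP => ?; apply: nr; constructor.
  move: nT; rewrite /terminal finset.in_setU negb_or => /andP[jU jD].
  have -> : agree masked (upd c (Some j) x) r = agree masked c r.
    apply: eq_forallb_in => v vm; rewrite upd_other//.
    by apply: contraNneq jD => <-; move/fintype.subsetP: masked_sub; apply.
  by rewrite !(updC _ _ (v := Some j) (w := None))// !(supported_upd _ x (gu_local gu) jU).
have agr c y : (forall l, Some l \in masked -> l != i -> c (Some l) = r (Some l)) ->
    (Some i \in masked -> y = r (Some i)) -> agree masked (upd c (Some i) y) r.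
  move=> cr yr; apply/agreeP => -[l|] lm; last by rewrite (negbTE None_masked) in lm.
  have [li|li] := eqVneq l i; first by subst l; rewrite upd_same yr.
  by rewrite upd_other ?cr.
have [iU|iU] := boolP (Some i \in PaU).
  have [x1 [x0 x10]] := two_states i.
  exists finset.set0, f0, x1, x0; split=> [|l|//|c cr]; rewrite ?finset.in_set0//.
  rewrite !gapE !agr ?finset.in_setD ?iU//.
  exact: (gu_chance gu).
have im : Some i \in masked.
  by move: Ti; rewrite /terminal finset.in_setU finset.in_setD (negbTE iU).
have [x0 x0r] : exists x0 : dom i, r (Some i) != x0.
  have [x [x' xx']] := two_states i; have [rx|rx] := eqVneq (r (Some i)) x.
    by exists x'; rewrite rx.
  by exists x.
exists finset.set0, f0, (r (Some i)), x0.
split=> [|l|//|c cr]; rewrite ?finset.in_set0// !gapE agr//.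
have -> : agree masked (upd c (Some i) x0) r = false.
  apply/negP => /agreeP/(_ _ im); rewrite upd_same => x0E.
  by rewrite x0E eqxx in x0r.
by rewrite subr_eq0; exact: (gu_decisions gu).
Qed.

(** Without the edge in [G'], the common table of [j] would ignore the state of [i], against
    [w_generic]. *)
Lemma edge_identified i j : K j = K' j -> edge G (chance i) (chance j) ->
  edge G' (chance i) (chance j).
Proof.
move=> KK' ij; have [y yP] := w_generic W ij.
have [x1 [x0 x10]] := two_states i.
have := yP c1 x1 x0 x10; apply: contraNT => nij; rewrite KK'.
have nPa : Some i \notin Pa G' (chance j) by rewrite inE.
by rewrite !(supported_upd _ _ (w_local W' (i := j)) nPa).
Qed.

(** The two-valued map at [j] passes the influence of [i] on the probability of [y] to the gap. By
    the third clause of [influences], [i] is too far away to act on the rest of the path, so the gap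
    changes by [(k1 - k0) * (h1 - h0)]. *)
Lemma edge_influences i j k r : edge G (chance i) (chance j) ->
  reach G k j -> (forall k', (k' <= k)%N -> ~ reach G k' i) ->
  upstream G j -> K j = K' j -> influences k r j -> influences k.+1 r i.
Proof.
move=> ij jk nreach up KK' [B [f [x1 [x0 [jB Bj indep eff]]]]].
have ij' := edge_identified KK' ij.
have [acy _] := w_graph W; have [acy' _] := w_graph W'.
have [y yP] := w_generic W ij; have [z1 [z0 z10]] := two_states i.
have gE c : gap K r (pin (j |: B) (set_map f j (two_valued y x1 x0)) c) =
    K j c y * gap K r (pin B f (upd c (Some j) x1)) +
    (1 - K j c y) * gap K r (pin B f (upd c (Some j) x0)).
  rewrite pin_setU1; apply: gap_two_valued W (upstream_decision W up) jB _.
  by move=> l /Bj[].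
have ji : j != i by apply: contraTneq ij => ->; apply/negP => /acy; rewrite connect0.
exists (j |: B), (set_map f j (two_valued y x1 x0)), z1, z0; split.
- rewrite finset.in_setU1 negb_or eq_sym ji /=; apply/negP => /Bj[ji' _].
  by move: (acy _ _ ij); rewrite ji'.
- move=> l /finset.setU1P[->|/Bj[jl jl']]; first by rewrite !connect1.
  by split; [apply: connect_trans jl|apply: connect_trans jl']; exact: connect1.
- move=> c v x nv.
  (* A parent of [j] would have a path of length [k.+1]. *)
  have nvj : Some v \notin Pa G (chance j).
    rewrite inE; apply/negP => vj.
    by apply: (nv k.+1) => //; apply: reach_edge jk.
  have vj : v != j by apply: contraPneq jk => <-; exact: (nv k (leqnSn k)).
  rewrite !gE (supported_upd _ _ (w_local W (i := j)) nvj).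
  rewrite !(updC _ _ (v := Some v) (w := Some j))//.
  by rewrite !(indep _ v x)// => k1 k1k; exact: (nv k1 (leqW k1k)).
- move=> c cr; rewrite !gE.
  rewrite !(updC _ _ (v := Some i) (w := Some j)) 1?[_ == Some j]eq_sym//.
  rewrite !(indep _ i z1)// !(indep _ i z0)// -subr_eq0.
  set h1 := gap _ _ _; set h0 := gap _ _ _.
  set k1 := K j _ y; set k0 := K j _ y.
  rewrite (_ : _ - _ = (k1 - k0) * (h1 - h0)); last by ring.
  rewrite mulf_neq0 ?subr_eq0//; first exact: yP.
  apply: eff => l lm lj; have [li|li] := eqVneq l i; last exact: cr.
  exfalso; apply: (nreach 0%N) => //; constructor; rewrite /terminal -li.
  by rewrite finset.in_setU (fintype.subsetP masked_sub) ?orbT.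
Qed.

(** The next variable [j] on a shortest path is at distance [k]; its identified table yields the
    edge from [i] to [j] in [G'] too, so the path serves both worlds. *)
Lemma reach_identified k i : reach G k i ->
  (forall k', (k' < k)%N -> ~ reach G k' i) ->
  [/\ K i = K' i, upstream G i, upstream G' i & forall r, influences k r i].
Proof.
elim: k i => [|k IHk] i ik nk.
  have Ti : terminal i by inversion ik.
  have up G0 : upstream G0 i by exists i.
  have infl r := terminal_influences r Ti.
  split=> //; apply: table_identified => // r; by exists 0%N.
have [j ij jk] : exists2 j, edge G (chance i) (chance j) & reach G k j.
  by inversion ik; exists j.
have [k' k'k jk'|KK' [t Tt jt] [t' Tt' jt'] infl] := IHk j jk.
  exact: (nk k'.+1 k'k (reach_edge ij jk')).
have ij' := edge_identified KK' ij.
have up : upstream G i by exists t => //; apply: connect_trans jt; exact: connect1.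
have up' : upstream G' i.
  by exists t' => //; apply: connect_trans jt'; exact: connect1.
have infli r : influences k.+1 r i.
  by apply: (edge_influences ij jk nk) => //; exists t.
by split=> //; apply: table_identified => // r; exists k.+1.
Qed.

(** A path to [U] first leaves the chance variables at a terminal one, so [i] has a distance. Being
    upstream in [G'] makes it an ancestor of [U] there, since [D] is a parent of [U]. *)
Lemma ancestor_identified i : chance i \in Anc G nodeU ->
  K i = K' i /\ chance i \in Anc G' nodeU.
Proof.
rewrite inE => /andP[_ /connectP[p pP pU]].
have UP : None \in PaU := gu_decision gu.
have [k ik] : exists k, reach G k i.
  elim: p i pP pU => [//|x p IHp] i /= /andP[ix xp] pU.
  case: x ix xp pU => [[j|]|] ix xp pU.
  - by have [k jk] := IHp _ xp pU; exists k.+1; exact: reach_edge jk.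
  - by exists 0%N; constructor; rewrite /terminal finset.in_setU -(w_PaD W) !inE ix orbT.
  - by exists 0%N; constructor; rewrite /terminal finset.in_setU -(w_PaU W) !inE ix.
have [k0 ik0 k0min] : exists2 k0, reach G k0 i & forall k', (k' < k0)%N -> ~ reach G k' i.
  have exk : exists k, `[< reach G k i >] by exists k; apply/asboolP.
  exists (ex_minn exk); case: ex_minnP => k1 /asboolP ik1 k1min //.
  by move=> k' k'k1 /asboolP /k1min; rewrite leqNgt k'k1.
have [KK' _ [t tT it] _] := reach_identified ik0 k0min.
split=> //; rewrite inE /=; apply: connect_trans it _.
move: tT; rewrite /terminal finset.in_setU => /orP[tU|tD].
  by apply: connect1; rewrite -(w_PaU W') inE in tU.
apply: (@connect_trans _ _ nodeD).
  by apply: connect1; rewrite -(w_PaD W') inE in tD.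
by apply: connect1; rewrite -(w_PaU W') inE in UP.
Qed.

End TwoWorlds.
End Worlds.

(** * The joint law of the ancestors of the utility *)

Section Ancestors.
Context (R : realType) (N : nat) (dom : 'I_N -> finType) (act : finType).
Local Notation outcome := (outcome dom act).
Local Notation vdom := (vdom dom act).
Local Notation proj := Defs.proj.
Local Notation table := (table R dom act).
Implicit Types (c r : outcome) (v w : var N).
Implicit Types (K : table) (u : outcome -> R).
Implicit Types (G : {set node N * node N}).

Lemma proj_supported (S : {set var N}) : supported S (@proj N dom act S).
Proof. by move=> c c' cc'; apply/ffunP => v; rewrite !ffunE cc' ?(valP v). Qed.

Definition factor K PaD (rho : policy R dom act PaD) v c : R :=
  if v is Some i then K i c (c (Some i)) else rho (proj PaD c) (c None).

Lemma prod_factor K PaD (rho : policy R dom act PaD) c :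
  \prod_v factor K rho v c = weight K c * rho (proj PaD c) (c None).
Proof.
rewrite (bigD1 None) //= mulrC /weight; congr (_ * _).
rewrite (reindex_omap Some id) => [|[]//].
by apply: eq_big => [i|i _]; rewrite ?eqxx.
Qed.

Lemma decision_not_ancestor G i : unmediated G ->
  chance i \in Anc G nodeU -> None \notin Pa G (chance i).
Proof.
move=> unm iU; rewrite inE; apply/negP => Di.
move/setP: unm => /(_ (chance i)).
by rewrite finset.in_setI iU andbT !inE /= (connect1 Di).
Qed.

(** As the task is unmediated, the chance ancestors of [U] are closed under parents and [sum_out]
    applies. On the right [D] has a point mass and the policy has disappeared. *)
Lemma sum_over_ancestors G K PaD (rho : policy R dom act PaD) (p : outcome)
    (F : outcome -> R) :
  cid_graph G -> unmediated G -> Pa G nodeD = PaD -> stochastic K ->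
  (forall i, supported (Pa G (chance i)) (K i)) -> is_kernel rho ->
  supported (chance_part (Anc G nodeU)) F ->
  \sum_c F c * (weight K c * rho (proj PaD c) (c None)) =
  \sum_c F c * \prod_v (if v \in chance_part (Anc G nodeU) then factor K rho v c
                        else (c v == p v)%:R).
Proof.
move=> [acy _] unm PaDE st loc krho SF; subst PaD.
under eq_bigr do rewrite -prod_factor.
have noloop x : ~~ edge G x x by apply/negP => /acy; rewrite connect0.
(* The number of nodes from which a variable can be reached increases strictly along edges. *)
apply: (sum_out (rk := fun v => #|[set x | connect (edge G) x (Some v)]%SET|)
  (pa := fun v => Pa G (Some v))) => //.
- move=> v w; rewrite inE => vw; apply: proper_card; apply/properP; split.
    apply/fintype.subsetP => x; rewrite !inE => xv.
    exact: connect_trans xv (connect1 vw).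
  by exists (Some w); rewrite !inE ?connect0 ?acy.
- move=> [i|]; rewrite !inE ?andbF// andbT /= => iU.
  apply/fintype.subsetP => v; rewrite !inE => vi.
  rewrite (connect_trans (connect1 vi) iU) /=.
  apply: contraTneq vi => ->.
  have /(decision_not_ancestor unm) : chance i \in Anc G nodeU by rewrite inE.
  by rewrite inE.
- move=> [i|] c c' cc' /=.
    rewrite cc' ?finset.setU11// (loc i c c')// => v vi.
    by rewrite cc' ?finset.in_setU1 ?vi ?orbT.
  rewrite cc' ?finset.setU11// (@proj_supported _ c c')// => v vi.
  by rewrite cc' ?finset.in_setU1 ?vi ?orbT.
- move=> [i|] _ c /=.
    rewrite -[RHS](st i c).2; apply: eq_bigr => y _; rewrite upd_same.
    by rewrite (supported_upd _ _ (loc i))// inE.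
  rewrite -[RHS](krho (proj _ c)).2; apply: eq_bigr => y _; rewrite upd_same.
  by rewrite (supported_upd _ _ (@proj_supported _))// inE.
Qed.

Definition ancestors_of G K PaD (rho : policy R dom act PaD) :
    ancestral_model R dom act :=
  @AncestralModel R N dom act (Anc G nodeU) (Defs.induced G (Anc G nodeU))
    [ffun x => marginal (fun c => weight K c * rho (proj PaD c) (c None)) x].

(** The type of the law depends on the node set, whose equality is therefore substituted before the
    laws are compared. *)
Lemma ancestral_model_eq (A A' : {set node N}) (E E' : {set node N * node N})
    (J J' : outcome -> R) : A = A' -> E = E' ->
  (forall x : config dom act (chance_part A), marginal J x = marginal J' x) ->
  @AncestralModel R N dom act A E [ffun x => marginal J x] =
  @AncestralModel R N dom act A' E' [ffun x => marginal J' x].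
Proof.
move=> <- <- JJ'; congr AncestralModel.
by apply/ffunP => x; rewrite !ffunE.
Qed.

Lemma ancestors_unique (PaU PaD : {set var N}) u
    (family : mixture R dom PaD -> policy R dom act PaD) G G' K K'
    (rho rho' : policy R dom act PaD) (r0 : outcome) :
  (forall i, (1 < #|dom i|)%N) -> generic_utility PaU u ->
  world PaU u family G K -> world PaU u family G' K' ->
  is_kernel rho -> is_kernel rho' ->
  ancestors_of G K rho = ancestors_of G' K' rho'.
Proof.
move=> hdom gu W W' krho krho'.
have best c : exists a, forall d, d != a -> u (upd c None d) < u (upd c None a).
  exists [arg max_(d > r0 None) u (upd c None d)]%O.
  case: arg_maxP => // a _ aP d da; rewrite lt_neqAle.
  by apply/andP; split; [exact: (gu_decisions gu)|exact: aP].
(* [a] is best at [r0] but beaten at some [c], where another decision [b] is best. *)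
have [a aP] := best r0; have [c [d ad]] := gu_undominated gu a.
have [b bP] := best c.
have ab : a != b.
  apply: contraTneq ad => ab; rewrite -leNgt ab; have [->//|db] := eqVneq d b.
  exact/ltW/bP.
have idW := ancestor_identified gu W W' ab aP bP hdom.
have idW' := ancestor_identified gu W' W ab aP bP hdom.
have chanceE i : (chance i \in Anc G nodeU) = (chance i \in Anc G' nodeU).
  by apply/idP/idP => [/idW[]|/idW'[]].
have DE G0 K0 : world PaU u family G0 K0 -> nodeD \in Anc G0 nodeU.
  move=> W0; rewrite inE /=; apply: connect1.
  by have := gu_decision gu; rewrite -(w_PaU W0) inE.
have AE : Anc G nodeU = Anc G' nodeU.
  apply/setP => -[[i|]|]; first exact: chanceE.
  - by rewrite (DE _ _ W) (DE _ _ W').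
  - by rewrite !inE.
apply: ancestral_model_eq => //.
  have PaE j : chance j \in Anc G nodeU -> Pa G (chance j) = Pa G' (chance j).
    move=> jA; have [KK' jA'] := idW j jA; apply/setP => -[i|].
      rewrite !inE; apply/idP/idP.
        exact: (edge_identified r0 W W' hdom KK').
      exact: (edge_identified r0 W' W hdom (esym KK')).
    rewrite (negbTE (decision_not_ancestor (w_unmediated W) jA)).
    by rewrite (negbTE (decision_not_ancestor (w_unmediated W') jA')).
  (* Edges into [D] are given by [PaD], and [U] is not among its own ancestors. *)
  rewrite /Defs.induced -AE; apply/setP => -[[x|] [[j|]|]]; rewrite !inE /= ?eqxx ?andbF//.
    have [jU|] := boolP (connect (edge G) (Some (Some j)) nodeU); rewrite ?andbF//.
    have /PaE/setP/(_ x) : chance j \in Anc G nodeU by rewrite inE.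
    by rewrite !inE /edge => ->.
  by have /setP/(_ x) := etrans (w_PaD W) (esym (w_PaD W')); rewrite !inE /edge => ->.
move=> x; rewrite /marginal; pose F c0 : R := (proj (chance_part (Anc G nodeU)) c0 == x)%:R.
have SF : supported (chance_part (Anc G nodeU)) F.
  by move=> c0 c1 /proj_supported; rewrite /F => ->.
have sumF J : \sum_(c0 | proj (chance_part (Anc G nodeU)) c0 == x) J c0 =
    \sum_c0 F c0 * J c0.
  rewrite big_mkcond; apply: eq_bigr => c0 _; rewrite /F.
  by case: ifP => _; rewrite ?mul1r ?mul0r.
rewrite !sumF (sum_over_ancestors r0 (w_graph W) (w_unmediated W) (w_PaD W)
  (w_stochastic W) (w_local W) krho SF).
rewrite AE in SF; rewrite (sum_over_ancestors r0 (w_graph W') (w_unmediated W')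
  (w_PaD W') (w_stochastic W') (w_local W') krho' SF) -AE.
apply: eq_bigr => c0 _; congr (_ * _); apply: eq_bigr => -[i|] _.
  case: ifP => //; rewrite inE andbT => /idW[KK' _].
  by rewrite /factor KK'.
by rewrite !inE andbF.
Qed.

End Ancestors.

(** * Reconstruction *)

Section Dominated.
Context (R : realType) (N : nat) (dom : 'I_N -> finType) (act : finType).
Context (G : {set node N * node N}).
Local Notation proj := Defs.proj.
Implicit Types (c : outcome dom act).

(** Always playing [a] is optimal in every environment: it attains the expectation of [F], which
    bounds the payoff of any policy and, as [D] does not act on the other ancestors of [U], is the
    same for all policies. *)
Lemma dominated_not_domain_dependent (u : utility R dom act (Pa G nodeU)) (a : act) :
  cid_graph G -> unmediated G ->
  (forall c d, u (proj _ (upd c None d)) <= u (proj _ (upd c None a))) ->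
  ~ domain_dependence u.
Proof.
move=> gG unm dominated [P1 [P2 [env1 env2]]].
pose rho : policy R dom act (Pa G nodeD) := fun=> fun d => (d == a)%:R.
have krho : is_kernel rho.
  move=> x; split=> [d|]; first by rewrite ler0n.
  by rewrite /rho (bigD1 a) //= eqxx big1 ?addr0// => d /negbTE ->.
suff opt P : is_environment P -> optimal u P rho.
  by move/(_ rho (opt _ env1)); apply; exact: opt.
move=> env; split=> // rho' krho'.
pose K : table R dom act := fun i c => P i (proj _ c).
pose F c := u (proj _ (upd c None a)).
have SF : supported (chance_part (Anc G nodeU)) F.
  move=> c c' cc'; congr u; apply: proj_supported => v vU.
  have [->|vN] := eqVneq v None; first by rewrite !upd_same.
  rewrite !upd_other//; apply: cc'; rewrite !inE vN andbT /=.
  by apply: connect1; rewrite inE in vU.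
have st : stochastic K by move=> i c; exact: env.
have loc i : supported (Pa G (chance i)) (K i).
  by move=> c c' /proj_supported; rewrite /K => ->.
have upd_None c : upd c None (c None) = c by exact: upd_id.
have [p _|no] := pickP {: outcome dom act}; last first.
  by rewrite /expected_utility !big1 // => c; have := no c.
have le1 : expected_utility u (joint P rho') <=
    \sum_c F c * (weight K c * rho' (proj _ c) (c None)).
  apply: ler_sum => c _; rewrite mulrC ler_wpM2r//.
    by rewrite mulr_ge0 ?(krho' _).1// prodr_ge0// => i _; exact: (env i _).1.
  by rewrite -{1}(upd_None c); exact: dominated.
apply: le_trans le1 _.
rewrite (sum_over_ancestors p gG unm erefl st loc krho' SF).
have -> : expected_utility u (joint P rho) =
    \sum_c F c * (weight K c * rho (proj _ c) (c None)).
  apply: eq_bigr => c _; rewrite mulrC /joint /rho.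
  case: eqP => [ca|_]; last by rewrite !mulr0.
  by rewrite /F -ca upd_None.
rewrite (sum_over_ancestors p gG unm erefl st loc krho SF) le_eqVlt.
apply/orP; left; apply/eqP; apply: eq_bigr => c _; congr (_ * _).
by apply: eq_bigr => -[i|] _ //; rewrite !inE andbF.
Qed.

End Dominated.

(** The index [k4] may repeat another one: the coefficient of [x k1] is 1 or 2, so the relation is
    never trivial. *)
Lemma lebesgue_null_cancellation (R : realType) (K : finType) (A : set (K -> R)) :
  (forall x, A x -> exists k1 k2 k3 k4, [/\ k1 != k2, k1 != k3 &
     x k1 - x k2 - x k3 + x k4 = 0]) ->
  lebesgue_null A.
Proof.
move=> AP; pose J := (K * K * K * K)%type.
pose P (j : J) := (j.1.1.1 != j.1.1.2) && (j.1.1.1 != j.1.2).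
pose a (j : J) k : R := (k == j.1.1.1)%:R - (k == j.1.1.2)%:R -
  (k == j.1.2)%:R + (k == j.2)%:R.
apply: (@lebesgue_null_hyperplanes R K J P a).
  move=> [[[k1 k2] k3] k4] /andP[/= k12 k13]; exists k1.
  rewrite /a /= eqxx (negbTE k12) (negbTE k13) !subr0.
  by rewrite gt_eqF// ltr_wpDr.
move=> x /AP[k1 [k2 [k3 [k4 [k12 k13 x0]]]]].
exists (k1, k2, k3, k4); first exact/andP.
have one t : \sum_k (k == t)%:R * x k = x t.
  rewrite (bigD1 t) //= eqxx mul1r big1 ?addr0// => k /negbTE ->.
  by rewrite mul0r.
rewrite -[RHS]x0 -(one k1) -(one k2) -(one k3) -(one k4) -!sumrB -big_split /=.
by apply: eq_bigr => k _; rewrite /a /= !mulrDl !mulNr.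
Qed.

Section Reconstruction.
Context (R : realType) (N : nat) (dom : 'I_N -> finType) (act : finType).
Local Notation proj := Defs.proj.

Definition explains (PaU PaD : {set var N}) (u : utility R dom act PaU)
    (family : mixture R dom PaD -> policy R dom act PaD)
    (am : ancestral_model R dom act) :=
  exists G K (rho : policy R dom act PaD),
    [/\ generic_utility PaU (fun c => u (proj PaU c)),
        world PaU (fun c => u (proj PaU c)) family G K, is_kernel rho &
        am = ancestors_of G K rho].

(** The empty model is a default for data that no generic world explains; otherwise
    [ancestors_unique] makes the choice immaterial in [reconstructP]. *)
Definition reconstruct : reconstruction R dom act :=
  fun PaU PaD u family =>
  if pselect (exists am, explains u family am) is left ex then projT1 (cid ex)
  else @AncestralModel R N dom act finset.set0 finset.set0 [ffun=> 0].

Lemma reconstructP PaU PaD (u : utility R dom act PaU)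
    (family : mixture R dom PaD -> policy R dom act PaD) am (r0 : outcome dom act) :
  (forall i, (1 < #|dom i|)%N) -> explains u family am ->
  reconstruct u family = am.
Proof.
move=> hdom ex; rewrite /reconstruct; case: pselect => [h|[]]; last by exists am.
case: (cid h) => am' /= [G' [K' [rho' [gu W' krho' ->]]]].
case: ex => G [K [rho [_ W krho ->]]].
exact: (ancestors_unique r0 hdom gu W' W).
Qed.

End Reconstruction.

Lemma reconstructs_generic (R : realType) (N : nat) (dom : 'I_N -> finType)
    (act : finType) (G : {set node N * node N}) (c0 : forall i, dom i)
    (theta : param act G c0 -> R) :
  (forall i, (1 < #|dom i|)%N) -> cid_graph G -> unmediated G ->
  is_environment (cpts_of theta) -> domain_dependence (utility_of theta) ->
  (forall k1 k2 k3 k4, k1 != k2 -> k1 != k3 ->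
    theta k1 - theta k2 - theta k3 + theta k4 != 0) ->
  reconstructs (@reconstruct R N dom act) (utility_of theta) (cpts_of theta).
Proof.
move=> hdom gG unm env dep gen family opt rho krho.
have [acy _] := gG.
(* For [k2 = k3 = k4] the four-term relation reduces to a difference of two parameters. *)
have neq k1 k2 : k1 != k2 -> theta k1 != theta k2.
  by move=> k12; have := gen k1 k2 k2 k2 k12 k12; rewrite subrK subr_eq0.
have x0 : config dom act (Pa G nodeD).
  apply: finfun => -[[i|] vD] /=; first exact: c0.
  by exfalso; move: vD; rewrite inE => DD; move: (acy _ _ DD); rewrite connect0.
have [d0 _] := distribution_support (krho x0).1 (krho x0).2.
have r0 : outcome dom act by apply: finfun => -[i|]; [exact: c0|exact: d0].
apply: (reconstructP r0 hdom).
pose K : table R dom act := fun i c =>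
  cpts_of theta (Defs.proj (Pa G (chance i)) c).
pose u c := utility_of theta (Defs.proj (Pa G nodeU) c).
have undom a : exists c d, u (upd c None a) < u (upd c None d).
  apply: contrapT => no; apply: (dominated_not_domain_dependent gG unm _ dep (a := a)).
  by move=> c d; rewrite leNgt; apply/negP => lt; apply: no; exists c, d.
have su : supported (Pa G nodeU) u by move=> c c' /proj_supported; rewrite /u => ->.
have UD : None \in Pa G nodeU.
  apply: contraT => nD; have [c [d]] := undom d0.
  by rewrite !(supported_upd _ _ su)// ltxx.
have projN (S : {set var N}) v (c c' : outcome dom act) :
    v \in S -> c v != c' v -> Defs.proj S c != Defs.proj S c'.
  move=> vS; apply: contraNneq => /ffunP/(_ (Sub v vS)).
  by rewrite !ffunE /= => ->.
exists G, K, rho; split=> //.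
  split=> // [c d d' dd'|c i x x' d d' iU xx' dd'].
    by apply: neq; rewrite (inj_eq inr_inj); apply: projN UD _; rewrite !upd_same.
  pose k c' : param act G c0 := inr (Defs.proj (Pa G nodeU) c').
  have kE (c1 c2 : outcome dom act) v : v \in Pa G nodeU -> c1 v != c2 v -> k c1 != k c2.
    by move=> vU c12; rewrite (inj_eq inr_inj); exact: projN vU c12.
  have k12 : k (upd (upd c (Some i) x) None d) != k (upd (upd c (Some i) x) None d').
    by apply: (kE _ _ None UD); rewrite !upd_same.
  have k13 : k (upd (upd c (Some i) x) None d) != k (upd (upd c (Some i) x') None d).
    by apply: (kE _ _ (Some i) iU); rewrite !(@upd_other _ _ _ _ None)// !upd_same.
  have := gen _ _ _ (k (upd (upd c (Some i) x') None d')) k12 k13.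
  apply: contraNneq => uE; apply/eqP; move: uE.
  by rewrite /u /utility_of /k; lra.
constructor=> //.
- by move=> i c; exact: env.
- by move=> i c c' /proj_supported; rewrite /K => ->.
(* The state must differ from [c0 j], whose entries are no free parameters; entries of distinct rows
   at [z] are distinct parameters. *)
- move=> i j ij; have [z zc0] : exists z, z != c0 j.
    have /card_gt1P[z [z' [_ _ zz']]] := hdom j.
    by have [zc0|] := eqVneq z (c0 j); [exists z'; rewrite -zc0 eq_sym|exists z].
  exists z => c x x' xx'; rewrite /K /cpts_of (insubT (fun z => z != c0 j) zc0).
  apply: neq; rewrite (inj_eq inl_inj) -tag_eqE /tag_eq /= eqxx /= tagged_asE.
  rewrite xpair_eqE negb_and; apply/orP; left.
  by apply: (projN _ (Some i)); rewrite ?inE// !upd_same.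
Qed.

Theorem theorem1 (R : realType) (N : nat) (dom : 'I_N -> finType) (act : finType)
    (hdom : forall i, (1 < #|dom i|)%N) :
  exists rec : reconstruction R dom act,
  forall (G : {set node N * node N}) (c0 : forall i, dom i),
    cid_graph G ->
    unmediated G ->
    lebesgue_null [set theta : param act G c0 -> R |
      let P := cpts_of theta in
      let u := utility_of theta in
      [/\ is_environment P, domain_dependence u & ~ reconstructs rec u P]].
Proof.
exists (@reconstruct R N dom act) => G c0 gG unm.
apply: lebesgue_null_cancellation => theta /= [env dep]; apply: contra_notP => no.
apply: reconstructs_generic => // k1 k2 k3 k4 k12 k13.
by apply/eqP => k0; apply: no; exists k1, k2, k3, k4.
Qed.
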